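(* Let $\lambda\in\mathbb R\setminus\{0\}$, let $n>1$, let $Q_1,Q_2$ be non-zero real homogeneous polynomials of degree $n$, and consider the system $\dot x=\lambda x+Q_1(x,y)$, $\dot y=\lambda y+Q_2(x,y)$. There is an infinite equilibrium of the system on the radius $\theta=\theta_0$ if and only if $g(\theta_0)=0$, and in this case: (a) the diameter $\theta=\theta_0$ is flow-invariant; (b) if $\lambda f(\theta_0)<0$ there is a unique finite equilibrium on the radius $\theta=\theta_0$; (c) if $\lambda f(\theta_0)\ge0$ there are no finite equilibria on the radius $\theta=\theta_0$.
   Context: $f(\theta)=\cos\theta\,Q_1(\cos\theta,\sin\theta)+\sin\theta\,Q_2(\cos\theta,\sin\theta)$ and $g(\theta)=\cos\theta\,Q_2(\cos\theta,\sin\theta)-\sin\theta\,Q_1(\cos\theta,\sin\theta)$, so that in polar coordinates the system is $\dot r=\lambda r+f(\theta)r^n$, $\dot\theta=g(\theta)r^{n-1}$. The radius $\theta=\theta_0$ is the half-line $\{\theta=\theta_0,\ r>0\}$ and the diameter $\theta=\theta_0$ is the line $\{\theta=\theta_0,\ r\in\mathbb R\}$. The system extends to the circle at infinity by the Poincaré compactification. In the chart $U_1$ (with $(x,y)=(1/v,u/v)$, $v>0$ in the finite plane) it is $\dot u=F(u)$, $\dot v=-\lambda v^n-vQ_1(1,u)$ with $F(u)=Q_2(1,u)-uQ_1(1,u)$; in the chart $U_2$ (with $(x,y)=(u/v,1/v)$) it is $\dot u=G(u)$, $\dot v=-\lambda v^n-vQ_2(u,1)$ with $G(u)=Q_1(u,1)-uQ_2(u,1)$;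 in the antipodal charts $V_1,V_2$ the expressions are those of $U_1,U_2$ multiplied by $(-1)^{n-1}$. The circle at infinity is $v=0$: the point $(u,0)$ of $U_1$ (resp. $U_2$) is the endpoint at infinity of the radius in the direction $(1,u)$ (resp. $(u,1)$), and the antipodal points lie in $V_1$, $V_2$. An infinite equilibrium is an equilibrium on the circle at infinity; it is on the radius $\theta=\theta_0$ if it is the endpoint at infinity of that radius. Finite equilibria are equilibria in $\mathbb R^2$. *)

(* Defs.v *)
From mathcomp Require Import all_boot all_order all_algebra.
From mathcomp Require Import all_classical all_reals all_analysis.
(* The notations of [mpoly] clash with those of mathcomp-analysis. *)
From mathcomp Require Import -(notations) mpoly.

Set Implicit Arguments.
Unset Strict Implicit.
Unset Printing Implicit Defensive.

Import Order.TTheory GRing.Theory Num.Theory.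
Import numFieldNormedType.Exports.

Local Open Scope classical_set_scope.
Local Open Scope ring_scope.

Definition bipoly (R : realType) := mpoly 2 R.

(* The zero polynomial is homogeneous of every degree. *)
Definition homogeneous (R : realType) (n : nat) (Q : bipoly R) : bool :=
  Q \is ishomog1 n mdeg.

Definition eval2 (R : realType) (Q : bipoly R) (x y : R) : R :=
  meval (fun i : 'I_2 => if i == ord0 then x else y) Q.

Definition system_field (R : realType) (lambda : R) (Q1 Q2 : bipoly R)
    (p : R * R) : R * R :=
  (lambda * p.1 + eval2 Q1 p.1 p.2, lambda * p.2 + eval2 Q2 p.1 p.2).

Definition finite_equilibrium (R : realType) (lambda : R) (Q1 Q2 : bipoly R)
    (p : R * R) : Prop :=
  system_field lambda Q1 Q2 p = (0, 0).

Definition polar_f (R : realType) (Q1 Q2 : bipoly R) (theta : R) : R :=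
  cos theta * eval2 Q1 (cos theta) (sin theta)
  + sin theta * eval2 Q2 (cos theta) (sin theta).

Definition polar_g (R : realType) (Q1 Q2 : bipoly R) (theta : R) : R :=
  cos theta * eval2 Q2 (cos theta) (sin theta)
  - sin theta * eval2 Q1 (cos theta) (sin theta).

Definition chart_F (R : realType) (Q1 Q2 : bipoly R) (u : R) : R :=
  eval2 Q2 1 u - u * eval2 Q1 1 u.

Definition chart_G (R : realType) (Q1 Q2 : bipoly R) (u : R) : R :=
  eval2 Q1 u 1 - u * eval2 Q2 u 1.

(* Push-forward of [system_field] to the chart, with time rescaled by the factor
   v ^+ n.-1 so that it extends to v = 0; q = (u, v). *)
Definition field_U1 (R : realType) (n : nat) (lambda : R) (Q1 Q2 : bipoly R)
    (q : R * R) : R * R :=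
  (chart_F Q1 Q2 q.1, - lambda * q.2 ^+ n - q.2 * eval2 Q1 1 q.1).

Definition field_U2 (R : realType) (n : nat) (lambda : R) (Q1 Q2 : bipoly R)
    (q : R * R) : R * R :=
  (chart_G Q1 Q2 q.1, - lambda * q.2 ^+ n - q.2 * eval2 Q2 q.1 1).

(* The local charts of the Poincare sphere that cover the circle at infinity.
   The coordinates of a point (z1, z2, z3) of the sphere are
   (z2 / z1, z3 / z1) in U1 (z1 > 0) and in V1 (z1 < 0), and
   (z1 / z2, z3 / z2) in U2 (z2 > 0) and in V2 (z2 < 0). *)
Variant chart := U1 | U2 | V1 | V2.

(* In V1 and V2 the finite points have v < 0, and the factor (-1) ^+ n.-1 makes
   the rescaling of time `|v| ^+ n.-1, which is positive. *)
Definition chart_field (R : realType) (n : nat) (lambda : R)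
    (Q1 Q2 : bipoly R) (c : chart) (q : R * R) : R * R :=
  match c with
  | U1 => field_U1 n lambda Q1 Q2 q
  | U2 => field_U2 n lambda Q1 Q2 q
  | V1 => (-1) ^+ n.-1 *: field_U1 n lambda Q1 Q2 q
  | V2 => (-1) ^+ n.-1 *: field_U2 n lambda Q1 Q2 q
  end.

(* Direction in the plane of the radii whose endpoint at infinity is the point
   of coordinates (u, 0) in the chart [c]. *)
Definition chart_direction (R : realType) (c : chart) (u : R) : R * R :=
  match c with
  | U1 => (1, u)
  | U2 => (u, 1)
  | V1 => (-1, - u)
  | V2 => (- u, -1)
  end.

Definition infinite_equilibrium (R : realType) (n : nat) (lambda : R)
    (Q1 Q2 : bipoly R) (c : chart) (q : R * R) : Prop :=
  q.2 = 0 /\ chart_field n lambda Q1 Q2 c q = (0, 0).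

Definition polar_radius (R : realType) (theta : R) : set (R * R) :=
  [set p | exists2 r : R, 0 < r & p = (r * cos theta, r * sin theta)].

Definition polar_diameter (R : realType) (theta : R) : set (R * R) :=
  [set p | exists r : R, p = (r * cos theta, r * sin theta)].

(* The radius is the open half-line spanned by its direction, so a point at
   infinity is its endpoint iff the direction attached to the point lies on
   the radius. *)
Definition endpoint_of_radius (R : realType) (theta : R) (c : chart)
    (q : R * R) : Prop :=
  q.2 = 0 /\ polar_radius theta (chart_direction c q.1).

Definition is_solution (R : realType) (X : R * R -> R * R) (J : set R)
    (gamma : R -> R * R) : Prop :=
  forall t : R, J t ->
    is_derive t 1 (fun s => (gamma s).1 : R) (X (gamma t)).1 /\
    is_derive t 1 (fun s => (gamma s).2 : R) (X (gamma t)).2.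

(* Invariance is in both time directions. *)
Definition flow_invariant (R : realType) (X : R * R -> R * R)
    (S : set (R * R)) : Prop :=
  forall (J : set R) (gamma : R -> R * R),
    open J -> is_interval J -> is_solution X J gamma ->
    forall t0 t : R, J t0 -> J t -> S (gamma t0) -> S (gamma t).

(* Main.v *)
Require Import Defs.
From mathcomp Require Import all_boot all_order all_algebra.
From mathcomp Require Import all_classical all_reals all_analysis.
From mathcomp Require Import -(notations) mpoly.
From mathcomp Require Import ring lra.
Import Order.TTheory GRing.Theory Num.Theory.
Import numFieldNormedType.Exports.
Local Open Scope ring_scope.

Set Implicit Arguments.
Unset Strict Implicit.

(** Write c and s for the cosine and sine of theta0, and f, g for the values of
    [polar_f] and [polar_g] at theta0.

    Infinite equilibria.  On v = 0 the second component of the field vanishes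
    in every chart, so equilibria are the zeros of [chart_F] or [chart_G].  By
    homogeneity, at the endpoint of the radius these two functions take the
    value g up to sign and up to a power of the nonzero scalar that takes
    (c, s) to (1, u) or (u, 1) ([chart_F_ray], [chart_G_ray]).  Since every
    radius has an endpoint in some chart, the equivalence follows.

    Finite equilibria.  Since (c, s) is a unit vector, g = 0 says that
    (Q1, Q2) is radial at (c, s), with value f (c, s) ([radial_values]).  Hence
    at r (c, s) the field is (lambda r + f r^n) (c, s) ([system_field_ray]) and
    for r > 0 it vanishes iff lambda + f r^(n-1) = 0.  This has exactly one
    positive root if lambda f < 0, and none if lambda f >= 0 because lambda
    times the left-hand side is then at least lambda^2 > 0.

    Invariance.  That the field is tangent to the diameter does not by itself
    confine the solutions to it: uniqueness of solutions is needed.  Let w be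
    the signed distance to the diameter along a solution.  The field is locally
    Lipschitz, being polynomial, and tangent to the diameter, so that
    |w'| <= K |w| on every compact time interval ([transverse_field_le]).  By
    an argument of Gronwall type ([derivable_zero_propagates]) w vanishes
    everywhere as soon as it vanishes at one time. *)

(** * Polynomials: homogeneity and local Lipschitz bounds *)

Lemma meval_scale (R : comNzRingType) (k d : nat) (Q : mpoly k R)
    (r : R) (v : 'I_k -> R) :
  Q \is ishomog1 d mdeg ->
  meval (fun i => r * v i) Q = r ^+ d * meval v Q.
Proof.
move=> /dhomogP hQ; rewrite !mevalE mulr_sumr.
apply: eq_big_seq => m /hQ <-.
under eq_bigr do rewrite exprMn.
by rewrite big_split /= prodrXr -mdegE mulrCA.
Qed.

Definition locally_lipschitz (R : realType) (k : nat)
    (F : ('I_k -> R) -> R) : Prop :=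
  forall M : R, exists2 L : R, 0 <= L &
    forall v w : 'I_k -> R,
      (forall i, `|v i| <= M) -> (forall i, `|w i| <= M) ->
      `|F v - F w| <= L * \sum_i `|v i - w i|.

(** Comparing with the value at 0 bounds the function on each box; the product
    rule needs this. *)
Lemma locally_lipschitz_bounded (R : realType) (k : nat)
    (F : ('I_k -> R) -> R) (M : R) :
  locally_lipschitz F ->
  exists2 B : R, 0 <= B & forall v, (forall i, `|v i| <= M) -> `|F v| <= B.
Proof.
move=> /(_ `|M|)[L L0 hL]; exists (`|F (fun=> 0)| + L * \sum_(i < k) `|M|).
  by rewrite addr_ge0// mulr_ge0// sumr_ge0.
move=> v hv; rewrite -{1}(subrK (F (fun=> 0)) (F v)) addrC.
have hv' i : `|v i| <= `|M| by exact: le_trans (hv i) (ler_norm M).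
rewrite (le_trans (ler_normD _ _))// lerD2l.
apply: (le_trans (hL _ _ hv' _)); first by move=> i; rewrite normr0.
by rewrite ler_wpM2l// ler_sum// => i _; rewrite subr0.
Qed.

Lemma locally_lipschitz_cst (R : realType) (k : nat) (c : R) :
  locally_lipschitz (fun _ : 'I_k -> R => c).
Proof. by move=> M; exists 0 => // v w _ _; rewrite subrr normr0 mul0r. Qed.

Lemma locally_lipschitz_coord (R : realType) (k : nat) (i : 'I_k) :
  locally_lipschitz (fun v : 'I_k -> R => v i).
Proof.
move=> M; exists 1 => // v w _ _.
by rewrite mul1r (bigD1 i)//= lerDl sumr_ge0.
Qed.

Lemma locally_lipschitzD (R : realType) (k : nat) (F G : ('I_k -> R) -> R) :
  locally_lipschitz F -> locally_lipschitz G ->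
  locally_lipschitz (fun v => F v + G v).
Proof.
move=> hF hG M; have [[L L0 hL] [L' L'0 hL']] := (hF M, hG M).
exists (L + L'); first exact: addr_ge0.
move=> v w hv hw; rewrite opprD addrACA mulrDl (le_trans (ler_normD _ _))//.
by apply: lerD; [exact: hL|exact: hL'].
Qed.

Lemma locally_lipschitzM (R : realType) (k : nat) (F G : ('I_k -> R) -> R) :
  locally_lipschitz F -> locally_lipschitz G ->
  locally_lipschitz (fun v => F v * G v).
Proof.
move=> hF hG M; have [[L L0 hL] [L' L'0 hL']] := (hF M, hG M).
have [B B0 hB] := locally_lipschitz_bounded M hF.
have [B' B'0 hB'] := locally_lipschitz_bounded M hG.
exists (B * L' + B' * L); first by rewrite addr_ge0// mulr_ge0.
move=> v w hv hw.
have -> : F v * G v - F w * G w = F v * (G v - G w) + G w * (F v - F w).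
  by ring.
rewrite mulrDl -!mulrA (le_trans (ler_normD _ _))// !normrM.
apply: lerD; apply: ler_pM => //; [exact: hB|exact: hL'|exact: hB'|exact: hL].
Qed.

(** Polynomials are built from constants and coordinates by sums and products,
    and the property passes through each of these. *)
Lemma locally_lipschitz_meval (R : realType) (k : nat) (Q : mpoly k R) :
  locally_lipschitz (fun v : 'I_k -> R => meval v Q).
Proof.
have hX (m : 'I_k -> nat) (s : seq 'I_k) :
    locally_lipschitz (fun v : 'I_k -> R => \prod_(i <- s) v i ^+ m i).
  elim: s => [|i s IH].
    by under eq_fun do rewrite big_nil; exact: locally_lipschitz_cst.
  under eq_fun do rewrite big_cons.
  apply: locally_lipschitzM IH; elim: (m i) => [|e IHe].
    exact: locally_lipschitz_cst.
  under eq_fun do rewrite exprS.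
  by apply: locally_lipschitzM IHe; exact: locally_lipschitz_coord.
elim/mpolyind: Q => [|c m p _ _ IH].
  by under eq_fun do rewrite meval0; exact: locally_lipschitz_cst.
under eq_fun do rewrite mevalD mevalZ mevalX.
apply: locally_lipschitzD IH; apply: locally_lipschitzM (hX _ _).
exact: locally_lipschitz_cst.
Qed.

(** * A linear differential inequality *)

Lemma is_derive_mean_value (R : realType) (h dh : R -> R) (a b : R) :
  a <= b -> (forall t, t \in `[a, b] -> is_derive t (1 : R) h (dh t)) ->
  exists2 c, c \in `[a, b] & h b - h a = dh c * (b - a).
Proof.
move=> ab hD.
have hc : {within `[a, b], continuous h}%classic.
  by apply: derivable_within_continuous => t /hD ht; exact: ex_derive.
have ho t : t \in `]a, b[ -> is_derive t (1 : R) h (dh t).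
  by move=> tab; apply: hD; exact: subset_itv_oo_cc.
by have [c cab e] := MVT_segment ab ho hc; exists c.
Qed.

(** The function w^2 e^(kt) has derivative (2 w w' + k w^2) e^(kt), and the
    assumption gives |2 w w'| <= 2 K w^2.  It is therefore nonincreasing for
    k = - 2 K and nondecreasing for k = 2 K; as it is nonnegative, the first
    choice carries a zero of w forward in time and the second backward. *)
Lemma derivable_zero_propagates (R : realType) (w dw : R -> R) (K a b : R) :
  a <= b ->
  (forall t, t \in `[a, b] -> is_derive t (1 : R) w (dw t)) ->
  (forall t, t \in `[a, b] -> `|dw t| <= K * `|w t|) ->
  w a = 0 <-> w b = 0.
Proof.
move=> ab dwE dwK.
pose h k t := w t ^+ 2 * expR (k * t).
pose dh k t := (w t * dw t *+ 2 + k * w t ^+ 2) * expR (k * t).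
have hD k t : t \in `[a, b] -> is_derive t (1 : R) (h k) (dh k t).
  move=> /dwE wt; rewrite /h /dh.
  apply: is_derive_eq.
  rewrite /GRing.scale /=; ring.
have hMVT k := is_derive_mean_value ab (hD k).
have K2 t : t \in `[a, b] -> `|w t * dw t *+ 2| <= 2 * K * w t ^+ 2.
  move=> /dwK Ht; rewrite normrMn normrM -(real_normK (num_real (w t))).
  by have := ler_wpM2l (normr_ge0 (w t)) Ht; rewrite expr2; lra.
have h0 k t : h k t <= 0 -> w t = 0.
  rewrite /h pmulr_lle0 ?expR_gt0// => ht; apply/eqP.
  by rewrite -sqrf_eq0 eq_le ht sqr_ge0.
split=> w0.
- have [c cab hc] := hMVT (- (2 * K)); apply: (h0 (- (2 * K))).
  move: hc; rewrite {2}/h w0 expr0n mul0r subr0 => ->.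
  rewrite mulr_le0_ge0 ?subr_ge0//.
  rewrite /dh pmulr_lle0 ?expR_gt0//.
  by move: (K2 _ cab); rewrite ler_norml; lra.
- have [c cab hc] := hMVT (2 * K); apply: (h0 (2 * K)).
  rewrite -oppr_ge0; move: hc; rewrite {1}/h w0 expr0n mul0r sub0r => ->.
  rewrite mulr_ge0 ?subr_ge0// /dh pmulr_lge0 ?expR_gt0//.
  by move: (K2 _ cab); rewrite ler_norml; lra.
Qed.

Lemma derivable_segment_bounded (R : realType) (f df : R -> R) (a b : R) :
  a <= b -> (forall t, t \in `[a, b] -> is_derive t (1 : R) f (df t)) ->
  exists2 M, 0 <= M & forall t, t \in `[a, b] -> `|f t| <= M.
Proof.
move=> ab fD.
have fc : {within `[a, b], continuous f}%classic.
  by apply: derivable_within_continuous => t /fD ft; exact: ex_derive.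
have [c _ fle] := EVT_max ab fc; have [d _ fge] := EVT_min ab fc.
exists (`|f c| + `|f d|) => [|t tab]; first exact: addr_ge0.
have := ler_norm (f c); have := lerNnormlW (lexx `|f d|).
have := normr_ge0 (f c); have := normr_ge0 (f d).
by have := fle _ tab; have := fge _ tab; rewrite ler_norml; lra.
Qed.

(** * The field along a line through the origin *)

Lemma eval2_scale (R : realType) (n : nat) (Q : bipoly R) (r x y : R) :
  homogeneous n Q -> eval2 Q (r * x) (r * y) = r ^+ n * eval2 Q x y.
Proof.
move=> hQ; rewrite /eval2 -(meval_scale _ _ hQ).
by apply: meval_eq => i; case: ifP.
Qed.

Lemma eval2_lipschitz (R : realType) (Q : bipoly R) (M : R) :
  exists2 L : R, 0 <= L & forall x y x' y' : R,
    `|x| <= M -> `|y| <= M -> `|x'| <= M -> `|y'| <= M ->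
    `|eval2 Q x y - eval2 Q x' y'| <= L * (`|x - x'| + `|y - y'|).
Proof.
have [L L0 hL] := locally_lipschitz_meval Q M.
exists L => // x y x' y' hx hy hx' hy'.
have := hL (fun i => if i == ord0 then x else y)
           (fun i => if i == ord0 then x' else y').
rewrite big_ord_recl big_ord1 /=; apply; by move=> i; case: ifP.
Qed.

Section Ray.
Variables (R : realType) (n : nat) (lambda : R) (Q1 Q2 : bipoly R) (theta : R).
Hypotheses (hQ1 : homogeneous n Q1) (hQ2 : homogeneous n Q2).

Let c := cos theta.
Let s := sin theta.

Lemma cos2Dsin2_mul : c * c + s * s = 1.
Proof. by rewrite -!expr2 cos2Dsin2. Qed.

(** The scalar r may be negative, which lets the same identity serve the chart
    V1: there the direction is - (1, u). *)
Lemma chart_F_ray (r : R) : r * c = 1 ->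
  chart_F Q1 Q2 (r * s) = r ^+ n.+1 * polar_g Q1 Q2 theta.
Proof.
move=> rc.
have E Q : homogeneous n Q -> eval2 Q 1 (r * s) = r ^+ n * eval2 Q c s.
  by move=> hQ; rewrite -(eval2_scale _ _ _ hQ) rc.
rewrite /chart_F !E// /polar_g -/c -/s exprS; ring: rc.
Qed.

(** The sign comes from the orientation: the coordinate of this chart is a
    cotangent, which decreases with the angle. *)
Lemma chart_G_ray (r : R) : r * s = 1 ->
  chart_G Q1 Q2 (r * c) = - (r ^+ n.+1 * polar_g Q1 Q2 theta).
Proof.
move=> rs.
have E Q : homogeneous n Q -> eval2 Q (r * c) 1 = r ^+ n * eval2 Q c s.
  by move=> hQ; rewrite -(eval2_scale _ _ _ hQ) rs.
rewrite /chart_G !E// /polar_g -/c -/s exprS; ring: rs.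
Qed.

Hypothesis g0 : polar_g Q1 Q2 theta = 0.

(** The numbers [polar_f] and [polar_g] are the radial and the angular component
    of (Q1, Q2) at the unit vector (c, s); the angular one is zero. *)
Lemma radial_values :
  eval2 Q1 c s = polar_f Q1 Q2 theta * c /\
  eval2 Q2 c s = polar_f Q1 Q2 theta * s.
Proof.
have cs := cos2Dsin2_mul; have /eqP := g0.
rewrite /polar_g subr_eq0 -/c -/s => /eqP gE.
rewrite /polar_f -/c -/s; split.
  by rewrite -{1}[eval2 Q1 c s]mul1r -cs; ring: gE.
by rewrite -{1}[eval2 Q2 c s]mul1r -cs; ring: gE.
Qed.

Lemma system_field_ray (r : R) :
  system_field lambda Q1 Q2 (r * c, r * s) =
  ((lambda * r + polar_f Q1 Q2 theta * r ^+ n) * c,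
   (lambda * r + polar_f Q1 Q2 theta * r ^+ n) * s).
Proof.
have [E1 E2] := radial_values.
rewrite /system_field /= !(eval2_scale _ _ _ hQ1, eval2_scale _ _ _ hQ2).
by rewrite E1 E2; congr pair; ring.
Qed.

Lemma finite_equilibrium_ray (r : R) : (0 < n)%N -> 0 < r ->
  finite_equilibrium lambda Q1 Q2 (r * c, r * s) <->
  lambda + polar_f Q1 Q2 theta * r ^+ n.-1 = 0.
Proof.
move=> n0 r0; rewrite /finite_equilibrium system_field_ray.
have -> : lambda * r + polar_f Q1 Q2 theta * r ^+ n =
          r * (lambda + polar_f Q1 Q2 theta * r ^+ n.-1).
  by rewrite -[in LHS](prednK n0) exprS; ring.
split=> [[E1 E2]|->]; last by rewrite mulr0 !mul0r.
apply: (mulfI (lt0r_neq0 r0)); rewrite mulr0.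
by rewrite -[LHS]mulr1 -cos2Dsin2_mul mulrDr !mulrA E1 E2 !mul0r addr0.
Qed.

(** Signed distance to the diameter when applied to a point, component normal to
    the diameter when applied to a vector of the field. *)
Definition transverse (p : R * R) : R := c * p.2 - s * p.1.

Lemma polar_diameterE (p : R * R) :
  polar_diameter theta p <-> transverse p = 0.
Proof.
have cs := cos2Dsin2_mul; split=> [[r ->]|].
  by rewrite /transverse /= -/c -/s; ring.
case: p => x y; rewrite /transverse /= => /eqP; rewrite subr_eq0 => /eqP w0.
exists (c * x + s * y); congr pair.
  by rewrite -/c -/s -[LHS]mul1r -cs; ring: w0.
by rewrite -/c -/s -[LHS]mul1r -cs; ring: w0.
Qed.

(** The projection of p to the diameter is rho (c, s), where the transverse
    component of the field is zero.  So that component at p is lambda times the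
    distance, plus the variation of Q1 and Q2 between p and its projection,
    which the Lipschitz bound controls by the distance. *)
Lemma transverse_field_le (M : R) :
  exists K : R, forall p : R * R, `|p.1| <= M -> `|p.2| <= M ->
    `|transverse (system_field lambda Q1 Q2 p)| <= K * `|transverse p|.
Proof.
have cs := cos2Dsin2_mul.
have c1 : `|c| <= 1 by rewrite ler_norml cos_geN1 cos_le1.
have s1 : `|s| <= 1 by rewrite ler_norml sin_geN1 sin_le1.
(* The projection of a point with coordinates at most M has coordinates at most
   2 M. *)
have [L1 L10 hL1] := eval2_lipschitz Q1 (2 * M).
have [L2 L20 hL2] := eval2_lipschitz Q2 (2 * M).
exists (`|lambda| + 2 * (L1 + L2)) => -[x y] /= hx hy.
have M0 : 0 <= M by exact: le_trans hx.
pose rho := c * x + s * y; pose w := transverse (x, y).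
have xE : x - rho * c = - s * w.
  by rewrite -[x in LHS]mul1r -cs /rho /w /transverse /=; ring.
have yE : y - rho * s = c * w.
  by rewrite -[y in LHS]mul1r -cs /rho /w /transverse /=; ring.
have rhoM : `|rho| <= 2 * M.
  have : `|c * x| <= M by rewrite normrM -[M]mul1r ler_pM.
  have : `|s * y| <= M by rewrite normrM -[M]mul1r ler_pM.
  by have := ler_normD (c * x) (s * y); rewrite -/rho; lra.
have rM z : `|z| <= 1 -> `|rho * z| <= 2 * M.
  by move=> z1; rewrite normrM -[2 * M]mulr1 ler_pM.
have dist : `|x - rho * c| + `|y - rho * s| <= 2 * `|w|.
  rewrite xE yE !normrM normrN.
  have := ler_wpM2r (normr_ge0 w) c1; have := ler_wpM2r (normr_ge0 w) s1.
  by rewrite !mul1r; lra.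
have M2 z : `|z| <= M -> `|z| <= 2 * M by lra.
have d1 : `|eval2 Q1 x y - eval2 Q1 (rho * c) (rho * s)| <= L1 * (2 * `|w|).
  apply: le_trans (ler_wpM2l L10 dist).
  by apply: hL1; [exact: M2|exact: M2|exact: rM|exact: rM].
have d2 : `|eval2 Q2 x y - eval2 Q2 (rho * c) (rho * s)| <= L2 * (2 * `|w|).
  apply: le_trans (ler_wpM2l L20 dist).
  by apply: hL2; [exact: M2|exact: M2|exact: rM|exact: rM].
have -> : transverse (system_field lambda Q1 Q2 (x, y)) =
    lambda * w
    + (c * (eval2 Q2 x y - eval2 Q2 (rho * c) (rho * s))
       - s * (eval2 Q1 x y - eval2 Q1 (rho * c) (rho * s))).
  have [E1 E2] := radial_values.
  rewrite !(eval2_scale _ _ _ hQ1, eval2_scale _ _ _ hQ2) E1 E2.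
  by rewrite /w /transverse /=; ring.
apply: (le_trans (ler_normD _ _)).
rewrite [leRHS]mulrDl [`|lambda * w|]normrM lerD2l.
apply: (le_trans (ler_normB _ _)); rewrite !normrM.
have := ler_pM (normr_ge0 _) (normr_ge0 _) c1 d2.
have := ler_pM (normr_ge0 _) (normr_ge0 _) s1 d1.
by rewrite !mul1r -/w; lra.
Qed.

(** Of two times in J either may be the earlier one, hence the equivalence:
    one direction propagates a zero forward, the other backward. *)
Lemma polar_diameter_invariant :
  flow_invariant (system_field lambda Q1 Q2) (polar_diameter theta).
Proof.
move=> J gamma _ Jitv sol.
have zero_iff a b : J a -> J b -> a <= b ->
    transverse (gamma a) = 0 <-> transverse (gamma b) = 0.
  move=> Ja Jb ab.
  have solab t : t \in `[a, b] -> _ := fun h => sol t (Jitv _ _ Ja Jb t h).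
  have xD t (h : t \in `[a, b]) := (solab t h).1.
  have yD t (h : t \in `[a, b]) := (solab t h).2.
  have [Mx Mx0 hMx] := derivable_segment_bounded ab xD.
  have [My My0 hMy] := derivable_segment_bounded ab yD.
  have [K hK] := transverse_field_le (Mx + My).
  apply: (derivable_zero_propagates (w := fun t => transverse (gamma t))
    (dw := fun t => transverse (system_field lambda Q1 Q2 (gamma t)))
    (K := K) ab).
    move=> t tab; have xt := xD t tab; have yt := yD t tab.
    exact: is_deriveB.
  move=> t tab; apply: hK.
    by rewrite (le_trans (hMx _ tab))// lerDl.
  by rewrite (le_trans (hMy _ tab))// lerDr.
move=> t0 t Jt0 Jt /polar_diameterE w0; apply/polar_diameterE.
have [le|/ltW le] := leP t0 t.
  by apply/(zero_iff _ _ Jt0 Jt le).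
by apply/(zero_iff _ _ Jt Jt0 le).
Qed.

End Ray.

(** * Equilibria at infinity *)

Section Infinity.
Variables (R : realType) (n : nat) (lambda : R) (Q1 Q2 : bipoly R) (theta : R).

(** At v = 0 the v-component of the field vanishes, and the sign factors
    of V1 and V2 do not affect the zeros, so that this function decides whether
    a point at infinity is an equilibrium. *)
Definition angular_component (c : chart) (u : R) : R :=
  match c with
  | U1 | V1 => chart_F Q1 Q2 u
  | U2 | V2 => chart_G Q1 Q2 u
  end.

Lemma infinite_equilibriumE (c : chart) (q : R * R) : (0 < n)%N -> q.2 = 0 ->
  infinite_equilibrium n lambda Q1 Q2 c q <-> angular_component c q.1 = 0.
Proof.
move=> n0; case: q => u v /= ->.
have v0 : (0 : R) ^+ n = 0 by rewrite expr0n -[n]prednK.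
have sgn0 : (-1 : R) ^+ n.-1 != 0 by rewrite signr_eq0.
split=> [[_]|]; case: c; rewrite /infinite_equilibrium /=.
- by case.
- by case.
- by case=> /eqP; rewrite mulf_eq0 (negPf sgn0) => /eqP.
- by case=> /eqP; rewrite mulf_eq0 (negPf sgn0) => /eqP.
- by rewrite /field_U1 /= v0 mulr0 mul0r subr0 => ->.
- by rewrite /field_U2 /= v0 mulr0 mul0r subr0 => ->.
- rewrite /field_U1 /= v0 mulr0 mul0r subr0 => ->.
  by split=> //; congr pair; rewrite /= scaler0.
- rewrite /field_U2 /= v0 mulr0 mul0r subr0 => ->.
  by split=> //; congr pair; rewrite /= scaler0.
Qed.

Lemma endpoint_of_radius_exists :
  exists (c : chart) (u : R), endpoint_of_radius theta c (u, 0).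
Proof.
have [c0|c0|c0] := ltgtP (cos theta) 0.
- exists V1, (sin theta / cos theta); split=> //; exists (- (cos theta)^-1).
    by rewrite oppr_gt0 invr_lt0.
  by rewrite /= !mulNr mulVf ?ltr0_neq0// [sin _ / _]mulrC.
- exists U1, (sin theta / cos theta); split=> //; exists (cos theta)^-1.
    by rewrite invr_gt0.
  by rewrite /= mulVf ?lt0r_neq0// [sin _ / _]mulrC.
have s1 : sin theta ^+ 2 = 1 by rewrite -(cos2Dsin2 theta) c0 expr0n add0r.
have /eqP := s1; rewrite sqrf_eq1 => /orP[] /eqP s0.
- by exists U2, 0; split=> //; exists 1; rewrite ?ltr01//= c0 s0 mulr0 mulr1.
- exists V2, 0; split=> //; exists 1; rewrite ?ltr01//=.
  by rewrite c0 s0 mulr0 mul1r oppr0.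
Qed.

(** In each chart the direction of the endpoint is r (c, s) with r > 0, that is,
    e r (c, s) is (1, u) or (u, 1) with e = 1 in U1 and U2 and e = - 1 in V1 and
    V2; the two ray identities then apply to e r. *)
Lemma angular_component_endpoint (c : chart) (q : R * R) :
  homogeneous n Q1 -> homogeneous n Q2 -> endpoint_of_radius theta c q ->
  angular_component c q.1 = 0 <-> polar_g Q1 Q2 theta = 0.
Proof.
move=> hQ1 hQ2 [_ [r r0 dirE]].
have zero_iff (e : R) (a g : R) : e != 0 -> a = e * g -> a = 0 <-> g = 0.
  move=> e0 ->; split=> [/eqP|->]; last by rewrite mulr0.
  by rewrite mulf_eq0 (negPf e0) => /eqP.
have rn0 : r ^+ n.+1 != 0 by rewrite expf_neq0// gt_eqF.
have Nrn0 : (- r) ^+ n.+1 != 0 by rewrite expf_neq0// oppr_eq0 gt_eqF.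
case: c dirE => /= -[].
- move=> rc ->; apply: (zero_iff _ _ _ rn0).
  exact: chart_F_ray.
- move=> -> rs; apply: (zero_iff (- r ^+ n.+1)); first by rewrite oppr_eq0.
  by rewrite mulNr; apply: (chart_G_ray hQ1 hQ2).
- move=> rc /eqP; rewrite eqr_oppLR -mulNr => /eqP ->.
  apply: (zero_iff _ _ _ Nrn0).
  by apply: chart_F_ray => //; rewrite mulNr -rc opprK.
- move=> /eqP; rewrite eqr_oppLR -mulNr => /eqP -> rs.
  apply: (zero_iff (- (- r) ^+ n.+1)); first by rewrite oppr_eq0.
  rewrite [RHS]mulNr; apply: (chart_G_ray hQ1 hQ2).
  by rewrite mulNr -rs opprK.
Qed.

End Infinity.

(** * Finite equilibria and conclusion *)

Lemma pos_root_exists (R : realType) (k : nat) (a : R) : (0 < k)%N -> 0 < a ->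
  exists2 r : R, 0 < r & r ^+ k = a.
Proof.
move=> k0 a0; exists (a `^ k%:R^-1); first exact: powR_gt0.
by rewrite -powR_mulrn ?powR_ge0// -powRrM mulVf ?powRr1 ?ltW// pnatr_eq0 -lt0n.
Qed.

Theorem proposition3p3 (R : realType) (n : nat) (lambda : R)
    (Q1 Q2 : bipoly R) (theta0 : R)
    (hlambda : lambda != 0) (hn : (1 < n)%N)
    (hQ1 : homogeneous n Q1) (hQ2 : homogeneous n Q2)
    (nzQ1 : Q1 != 0) (nzQ2 : Q2 != 0) :
  ((exists (c : chart) (q : R * R),
      infinite_equilibrium n lambda Q1 Q2 c q /\ endpoint_of_radius theta0 c q)
   <-> polar_g Q1 Q2 theta0 = 0)
  /\ (polar_g Q1 Q2 theta0 = 0 ->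
      [/\ flow_invariant (system_field lambda Q1 Q2) (polar_diameter theta0),
          lambda * polar_f Q1 Q2 theta0 < 0 ->
            exists! p : R * R,
              polar_radius theta0 p /\ finite_equilibrium lambda Q1 Q2 p
        & 0 <= lambda * polar_f Q1 Q2 theta0 ->
            ~ (exists p : R * R,
                 polar_radius theta0 p /\ finite_equilibrium lambda Q1 Q2 p)]).
Proof.
have n0 : (0 < n)%N by exact: ltnW.
have n1 : (0 < n.-1)%N by rewrite -ltnS prednK.
split.
  split=> [[c [q [eq_q end_q]]]|g0].
    have q0 : q.2 = 0 by case: end_q.
    apply/(angular_component_endpoint hQ1 hQ2 end_q).
    exact/(infinite_equilibriumE lambda Q1 Q2 c n0 q0).
  have [c [u end_u]] := endpoint_of_radius_exists theta0.
  exists c, (u, 0); split=> //; apply/infinite_equilibriumE => //.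
  exact/(angular_component_endpoint hQ1 hQ2 end_u).
move=> g0.
have eqE (r : R) (r0 : 0 < r) := finite_equilibrium_ray lambda hQ1 hQ2 g0 n0 r0.
set f := polar_f Q1 Q2 theta0 in eqE *; split.
- exact: polar_diameter_invariant hQ1 hQ2 g0.
- move=> lf0.
  have f0 : f != 0 by apply: contraTneq lf0 => ->; rewrite mulr0 ltxx.
  have a0 : 0 < - lambda / f.
    have -> : - lambda / f = - (lambda * f) / f ^+ 2 by field.
    by rewrite divr_gt0 ?oppr_gt0// exprn_even_gt0.
  have [r r0 rE] := pos_root_exists n1 a0.
  exists (r * cos theta0, r * sin theta0); split.
    split; first by exists r.
    by apply/(eqE _ r0); rewrite rE mulrC divfK// subrr.
  move=> _ [[r' r'0 ->] /(eqE _ r'0) r'E].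
  suff -> : r = r' by [].
  apply: (pexpIrn n1); rewrite ?nnegrE ?ltW// rE.
  by apply: (mulfI f0); rewrite mulrC divfK//; lra.
- move=> lf0 [_ [[r r0 ->] /(eqE _ r0) rE]].
  have : 0 < lambda * (lambda + f * r ^+ n.-1).
    have l2 : 0 < lambda ^+ 2 by rewrite exprn_even_gt0.
    have rk : 0 <= r ^+ n.-1 by rewrite exprn_ge0// ltW.
    have := mulr_ge0 lf0 rk; rewrite -mulrA => lfr.
    by rewrite mulrDr -expr2 ltr_wpDr.
  by rewrite rE mulr0 ltxx.
Qed.
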